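(* Let $G$ be a connected graph of order $n\geq 4$ with vertex connectivity $k$. Then $$ASO(G)\leq k\sqrt{\frac{(n-1)^2+k^2}{n+k-3}}+\binom{k}{2}\sqrt{n+\frac{1}{n-2}}+k(n-k-1)\sqrt{n-\frac{1}{2}+\frac{5}{2(2n-5)}}+\binom{n-k-1}{2}\sqrt{n-1+\frac{1}{n-3}},$$ with equality if and only if $G\cong (K_1\cup K_{n-k-1})\vee K_k$ when $k\leq n-2$, and $G\cong K_n$ when $k=n-1$.
   Context: All graphs are finite and simple. The vertex connectivity of a nontrivial connected graph is the minimum number of vertices whose removal results in a disconnected or trivial graph. $K_m$ is the complete graph on $m$ vertices; $G\cup H$ is the disjoint union of vertex-disjoint graphs $G,H$; the join $G\vee H$ is obtained from $G\cup H$ by adding all edges between every vertex of $G$ and every vertex of $H$. For a graph $G$ with no connected component isomorphic to $P_2$, the augmented Sombor index is $ASO(G)=\sum_{v_iv_j\in E(G)}\sqrt{\frac{d_i^2+d_j^2}{d_i+d_j-2}}$, where $d_i$ is the degree of $v_i$ in $G$. *)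

(* Defs.v *)
From mathcomp Require Import all_boot all_order all_algebra.
From mathcomp Require Import reals.

Set Implicit Arguments.
Unset Strict Implicit.
Unset Printing Implicit Defensive.

Import Order.TTheory GRing.Theory Num.Theory.
Local Open Scope ring_scope.

Record sgraph := SGraph {
  vertex :> finType;
  adj : rel vertex;
  adj_sym : symmetric adj;
  adj_irrefl : irreflexive adj }.

Definition isomorphic (G H : sgraph) : Prop :=
  exists2 f : G -> H, bijective f & {mono f : x y / adj x y}.

Lemma complete_sym m : symmetric [rel x y : 'I_m | x != y].
Proof. by move=> x y; rewrite /= eq_sym. Qed.

Lemma complete_irrefl m : irreflexive [rel x y : 'I_m | x != y].
Proof. by move=> x; rewrite /= eqxx. Qed.

Definition complete (m : nat) : sgraph :=
  SGraph (@complete_sym m) (@complete_irrefl m).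

Section UnionJoin.
Variables G H : sgraph.

(* [b] is the adjacency between the two sides of the disjoint sum. *)
Definition sum_adj (b : bool) : rel (G + H)%type := fun u v =>
  match u, v with
  | inl x, inl y => adj x y
  | inr x, inr y => adj x y
  | _, _ => b
  end.

Lemma sum_adj_sym b : symmetric (sum_adj b).
Proof. by case=> x [] y //=; apply: adj_sym. Qed.

Lemma sum_adj_irrefl b : irreflexive (sum_adj b).
Proof. by case=> x /=; apply: adj_irrefl. Qed.

Definition disjoint_union : sgraph :=
  SGraph (@sum_adj_sym false) (@sum_adj_irrefl false).

Definition join : sgraph :=
  SGraph (@sum_adj_sym true) (@sum_adj_irrefl true).

End UnionJoin.

Definition connected (G : sgraph) : bool :=
  [forall x : G, forall y : G, connect (@adj G) x y].

Section Connectivity.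
Variable G : sgraph.

Definition remaining (S : {set G}) : finType := {x : G | x \notin S}.

Definition remaining_adj (S : {set G}) : rel (remaining S) :=
  fun x y => adj (val x) (val y).

Lemma remaining_adj_sym S : symmetric (@remaining_adj S).
Proof. by move=> x y; apply: adj_sym. Qed.

Lemma remaining_adj_irrefl S : irreflexive (@remaining_adj S).
Proof. by move=> x; apply: adj_irrefl. Qed.

Definition remove_vertices (S : {set G}) : sgraph :=
  SGraph (@remaining_adj_sym S) (@remaining_adj_irrefl S).

(* The empty graph counts as trivial; this makes [setT] always admissible and
   does not change the minimum for a nonempty graph. *)
Definition disconnecting (S : {set G}) : bool :=
  (#|remove_vertices S| <= 1)%N || ~~ connected (remove_vertices S).

Definition vertex_connectivity : nat :=
  #|[arg min_(S < [set: G] | disconnecting S) #|S|]|.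

End Connectivity.

Section AugmentedSombor.
Variables (R : realType) (G : sgraph).

Definition degree (v : G) : nat := #|[set w : G | adj v w]|.

Definition edges : {set {set G}} :=
  [set [set p.1; p.2] | p : G * G & adj p.1 p.2].

(* For an edge [E = [set x; y]] (so [x != y]) the inner sums over [E] are
   [d_x ^ 2 + d_y ^ 2] and [d_x + d_y].  An edge forming a [P_2] component
   has denominator 0 and hence, by the convention on inverses, contributes 0. *)
Definition ASO : R :=
  \sum_(E in edges)
    Num.sqrt ((\sum_(v in E) (degree v)%:R ^+ 2)
              / (\sum_(v in E) (degree v)%:R - 2)).

End AugmentedSombor.

Arguments ASO R G : clear implicits.

Definition ASO_bound (R : realType) (n k : nat) : R :=
  k%:R * Num.sqrt (((n%:R - 1) ^+ 2 + k%:R ^+ 2) / (n%:R + k%:R - 3))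
  + 'C(k, 2)%:R * Num.sqrt (n%:R + 1 / (n%:R - 2))
  + (k * (n - k - 1))%:R
      * Num.sqrt (n%:R - 1 / 2 + 5 / (2 * (2 * n%:R - 5)))
  + 'C(n - k - 1, 2)%:R * Num.sqrt (n%:R - 1 + 1 / (n%:R - 3)).

Arguments ASO_bound R n k : clear implicits.

(* Main.v *)
(* Write f(a, b) for the weight of an edge with end degrees a and b.  Raising a
   by one lowers f(a, b) by at most 1 / (2 sqrt(a + 1)).  So joining two
   nonadjacent vertices of degrees a and b costs at most
   a / (2 sqrt(a + 1)) + b / (2 sqrt(b + 1)), less than the weight
   f(a + 1, b + 1) of the new edge: in a connected graph, adding an edge strictly
   increases ASO.  Hence G may be completed to (K_a u K_b) v K_k, where
   a + b = n - k.
   If a, b >= 2, compare with (K_1 u K_{n-k-1}) v K_k: every edge weight of the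
   former is at most f(n-1, n-1), f(n-1, n-2) or f(n-2, n-2), according to how
   many ends lie in K_k.  The latter has (a - 1)(b - 1) more edges of
   weight f(n-2, n-2), and this outweighs the deficit
   k (f(n-1, n-2) - f(n-1, k)) at the vertex of degree k. *)
Require Import Defs.
From mathcomp Require Import all_boot all_order all_algebra.
From mathcomp Require Import reals.
From mathcomp Require Import ring lra zify.

Set Implicit Arguments.
Unset Strict Implicit.
Unset Printing Implicit Defensive.

Import Order.TTheory GRing.Theory Num.Theory.
Local Open Scope ring_scope.

(** * Estimates for the edge weight f(a, b) *)

Section Weight.
Variable R : realType.

Definition weight (a b : nat) : R :=
  Num.sqrt ((a%:R ^+ 2 + b%:R ^+ 2) / (a%:R + b%:R - 2)).

Lemma weightC a b : weight a b = weight b a.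
Proof. by rewrite /weight addrC [b%:R + _]addrC. Qed.

Lemma weight_ge0 a b : 0 <= weight a b.
Proof. exact: sqrtr_ge0. Qed.

(** Multiplied by a + b - 2, the difference of the two sides is (a - b)^2 / 2 + 2. *)
Lemma weight_radicand_ge a b : (3 <= a + b)%N ->
  (a%:R + b%:R) / 2 + 1 <= (a%:R ^+ 2 + b%:R ^+ 2) / (a%:R + b%:R - 2) :> R.
Proof.
move=> ab; have {}ab : 3 <= a%:R + b%:R :> R by rewrite -natrD ler_nat.
rewrite ler_pdivlMr; last by lra.
by have := sqr_ge0 (a%:R - b%:R : R); nra.
Qed.

Lemma weight_sqr a b : (3 <= a + b)%N ->
  weight a b ^+ 2 = (a%:R ^+ 2 + b%:R ^+ 2) / (a%:R + b%:R - 2).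
Proof.
move=> ab; rewrite sqr_sqrtr //; apply: le_trans (weight_radicand_ge ab).
by rewrite -natrD addr_ge0 // divr_ge0.
Qed.

Lemma weight_sqr_ge a b : (3 <= a + b)%N ->
  (a%:R + b%:R) / 2 + 1 <= weight a b ^+ 2.
Proof. by move=> ab; rewrite weight_sqr // weight_radicand_ge. Qed.

Lemma le_weight a b c d :
  (a%:R ^+ 2 + b%:R ^+ 2) / (a%:R + b%:R - 2)
    <= (c%:R ^+ 2 + d%:R ^+ 2) / (c%:R + d%:R - 2) :> R ->
  weight a b <= weight c d.
Proof. exact: ler_wsqrtr. Qed.

(** If b <= a, raising a does not lower the weight at all. Otherwise the radicand falls by at most 1
    while both weights X and Y are at least s = sqrt(a + 1), so X - Y = (X^2 - Y^2) / (X + Y) is at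
    most 1 / (2 s). *)
Lemma weight_drop a b : (0 < a)%N -> (0 < b)%N -> (3 <= a + b)%N ->
  weight a b - weight a.+1 b <= (2 * Num.sqrt a.+1%:R)^-1.
Proof.
move=> a0 b0 ab; have sa : 0 < Num.sqrt a.+1%:R :> R by rewrite sqrtr_gt0 ltr0n.
have aR : 1 <= a%:R :> R by rewrite ler1n.
have bR : 1 <= b%:R :> R by rewrite ler1n.
have abR : 3 <= a%:R + b%:R :> R by rewrite -natrD ler_nat.
have a1 : a.+1%:R = a%:R + 1 :> R by rewrite -natr1.
have [le_ba|lt_ab] := leqP b a.
  have baR : b%:R <= a%:R :> R by rewrite ler_nat.
  apply: (@le_trans _ _ 0); last by rewrite invr_ge0 mulr_ge0 // ltW.
  rewrite subr_le0; apply: le_weight.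
  rewrite ler_pdivrMr; last by lra.
  rewrite mulrAC ler_pdivlMr; last by lra.
  rewrite a1.
  have : 0 <= (a%:R - b%:R) * (a%:R - 1) :> R by apply: mulr_ge0; lra.
  have : 2 <= a%:R :> R by rewrite ler_nat; lia.
  nra.
have baR : a%:R + 1 <= b%:R :> R by rewrite -a1 ler_nat.
have X2 := weight_sqr ab; have Xge := weight_sqr_ge ab.
have ab' : (3 <= a.+1 + b)%N by lia.
have Y2 := weight_sqr ab'; have Yge := weight_sqr_ge ab'.
have X0 := weight_ge0 a b; have Y0 := weight_ge0 a.+1 b.
have s2 : Num.sqrt a.+1%:R ^+ 2 = a%:R + 1 :> R by rewrite sqr_sqrtr ?ler0n.
(* Cleared of denominators, this says that 2 (a - 1) (a + b) + 2 a (b - 2) is nonnegative. *)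
have dg : weight a b ^+ 2 <= weight a.+1 b ^+ 2 + 1.
  rewrite X2 Y2 a1 ler_pdivrMr; last by lra.
  have -> : ((a%:R + 1) ^+ 2 + b%:R ^+ 2) / (a%:R + 1 + b%:R - 2) + 1 =
     ((a%:R + 1) ^+ 2 + b%:R ^+ 2 + a%:R + 1 + b%:R - 2)
       / (a%:R + 1 + b%:R - 2) :> R.
    by field; apply/eqP; lra.
  rewrite mulrAC ler_pdivlMr; last by lra.
  have : 0 <= (a%:R - 1) * (a%:R + b%:R) :> R by apply: mulr_ge0; lra.
  have : 0 <= a%:R * (b%:R - 2) :> R by apply: mulr_ge0; lra.
  nra.
move: Xge Yge dg s2 sa X0 Y0; rewrite a1.
move: (weight a b) (weight a.+1 b) (Num.sqrt _) => X Y s Xge Yge dg s2 sa X0 Y0.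
have sX : s <= X by rewrite -(ler_pXn2r (n := 2)) // ?nnegrE ?ltW //; nra.
have sY : s <= Y by rewrite -(ler_pXn2r (n := 2)) // ?nnegrE ?ltW //; nra.
rewrite -[_^-1]mul1r ler_pdivlMr; last by lra.
have [|lt_YX] := leP X Y; nra.
Qed.

(** By [weight_sqr_ge], (sqrt a + sqrt b)^2 <= 2 (a + b) < 4 f(a, b)^2. Applied to the raised
    degrees, this makes a new edge outweigh the losses at its ends. *)
Lemma weight_gt_half a b : (3 <= a + b)%N ->
  Num.sqrt a%:R + Num.sqrt b%:R < 2 * weight a b.
Proof.
move=> ab.
have aux (p q w x y : R) : 0 <= p -> 0 <= q -> 0 <= w ->
    p ^+ 2 = x -> q ^+ 2 = y -> (x + y) / 2 + 1 <= w ^+ 2 -> p + q < 2 * w.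
  move=> p0 q0 w0 p2 q2 w2.
  rewrite -(ltr_pXn2r (n := 2)) // ?nnegrE ?addr_ge0 ?mulr_ge0 //.
  by have := sqr_ge0 (p - q); nra.
by apply: aux (weight_sqr_ge ab); rewrite ?sqrtr_ge0 ?sqr_sqrtr.
Qed.

(** On the diagonal the radicand is a^2 / (a - 1), nondecreasing from a = 2 on. *)
Lemma weight_diag_mono a b : (2 <= a)%N -> (a <= b)%N ->
  weight a a <= weight b b.
Proof.
move=> a2 ab; apply: le_weight.
have aR : 2 <= a%:R :> R by rewrite ler_nat.
have abR : a%:R <= b%:R :> R by rewrite ler_nat.
rewrite ler_pdivrMr; last by lra.
rewrite mulrAC ler_pdivlMr; last by lra.
have : 0 <= (b%:R - a%:R) * (a%:R * (b%:R - 2) + b%:R * (a%:R - 2)) :> R.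
  by apply: mulr_ge0; [lra | apply: addr_ge0; apply: mulr_ge0; lra].
nra.
Qed.

(* As a function of [d], the radicand takes its value at [d = c] also at
   [d = (3c + 1) / (2c - 1) <= 2], and lies below that value in between. *)
Lemma weight_le_corner c d : (3 <= c)%N -> (2 <= d <= c)%N ->
  weight c.+1 d <= weight c.+1 c.
Proof.
move=> c3 /andP[d2 dc]; apply: le_weight; rewrite -natr1.
have cR : 3 <= c%:R :> R by rewrite ler_nat.
have dR : 2 <= d%:R :> R by rewrite ler_nat.
have dcR : d%:R <= c%:R :> R by rewrite ler_nat.
rewrite ler_pdivrMr; last by lra.
rewrite mulrAC ler_pdivlMr; last by lra.
have : 0 <= (c%:R - d%:R) * ((2 * c%:R - 1) * d%:R - (3 * c%:R + 1)) :> R.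
  by apply: mulr_ge0; [lra | nra].
nra.
Qed.

End Weight.

(** * From edges to arcs *)

Definition rdegree (V : finType) (e : rel V) (x : V) : nat :=
  #|[set y | e x y]|.

(* Every edge is counted once in each direction. *)
Definition arc_sum (R : realType) (V : finType) (e : rel V) : R :=
  \sum_(p : V * V | e p.1 p.2) weight R (rdegree e p.1) (rdegree e p.2).

Lemma eq_arc_sum (R : realType) (V : finType) (e e' : rel V) :
  e =2 e' -> arc_sum R e = arc_sum R e'.
Proof.
move=> E; have dE x : rdegree e x = rdegree e' x.
  by apply: eq_card => y; rewrite !inE E.
by apply: eq_big => [p|p _]; rewrite ?E ?dE.
Qed.

Lemma eq_set2 (V : finType) (x y u v : V) : x != y ->
  ([set u; v] == [set x; y]) = ((u, v) \in [set (x, y); (y, x)]).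
Proof.
move=> xy; rewrite in_set2 !xpair_eqE; apply/eqP/orP; last first.
  by case=> /andP[/eqP-> /eqP->] //; rewrite setUC.
move=> E.
have : x \in [set u; v] by rewrite E set21.
have : y \in [set u; v] by rewrite E set22.
rewrite !in_set2 !(eq_sym _ u) !(eq_sym _ v).
case: eqP => [uy _|_ /= vy]; last first.
  rewrite vy; case: eqP => [|_] /=; first by left.
  by move=> /eqP vx; rewrite -vx (eqP vy) eqxx in xy.
case: eqP => [ux|_ /= vx]; first by rewrite -ux -uy eqxx in xy.
by right.
Qed.

Lemma ASO_arc_sum (R : realType) (G : sgraph) :
  ASO R G *+ 2 = arc_sum R (@adj G).
Proof.
rewrite /arc_sum /ASO -sumrMnl.
(* Arcs are grouped by the edge they span; each group is {(x, y), (y, x)}, and both arcs have the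
   same weight. *)
rewrite (partition_big (fun p => [set p.1; p.2])
           (fun E => E \in edges G)) /=; last first.
  by move=> p ap; apply/imsetP; exists p; rewrite ?inE.
apply: eq_bigr => E /imsetP[[x y]]; rewrite inE /= => axy ->.
have xy : x != y by apply: contraTneq axy => ->; rewrite adj_irrefl.
rewrite (eq_bigl (mem [set (x, y); (y, x)])); last first.
  case=> u v /=; rewrite eq_set2 // andb_idl // in_set2 !xpair_eqE.
  by move=> /orP[] /andP[/eqP-> /eqP->] //; rewrite adj_sym.
rewrite !big_setU1 ?inE ?xpair_eqE ?(negbTE xy) //= !big_set1 /=.
by rewrite [X in _ = _ + X]weightC -mulr2n.
Qed.

(** Otherwise x and y would be each other's only neighbours and {x, y} a whole component, impossible
    with three vertices. This keeps a + b - 2 positive in the weights of edges. *)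
Lemma edge_rdegree_ge3 (V : finType) (e : rel V) (x y : V) :
  symmetric e -> irreflexive e -> (forall u v, connect e u v) ->
  (3 <= #|V|)%N -> e x y -> (3 <= rdegree e x + rdegree e y)%N.
Proof.
move=> sym irr con V3 exy.
have xy : x != y by apply: contraTneq exy => ->; rewrite irr.
rewrite leqNgt; apply/negP => lt3.
have dx : (0 < rdegree e x)%N by apply/card_gt0P; exists y; rewrite inE.
have dy : (0 < rdegree e y)%N by apply/card_gt0P; exists x; rewrite inE sym.
have Nx : [set z | e x z] = [set y].
  apply/esym/eqP; rewrite eqEcard sub1set inE exy cards1.
  by move: lt3 dy; rewrite /rdegree; lia.
have Ny : [set z | e y z] = [set x].
  apply/esym/eqP; rewrite eqEcard sub1set inE sym exy cards1.
  by move: lt3 dx; rewrite /rdegree; lia.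
have exP z : e x z = (z == y) by rewrite -[e x z]inE -[RHS]in_set1 -Nx inE.
have eyP z : e y z = (z == x) by rewrite -[e y z]inE -[RHS]in_set1 -Ny inE.
have clo : closed e (mem [set x; y]).
  apply: intro_closed => [u v|u v euv]; first exact/sym_connect_sym.
  rewrite !inE => /orP[] /eqP uE; move: euv; rewrite uE ?exP ?eyP => ->;
  by rewrite ?orbT.
have : (#|V| <= #|[set x; y]|)%N.
  apply/subset_leq_card/subsetP => z _.
  by rewrite -(closed_connect clo (con x z)) set21.
by rewrite cards2; move: V3; case: (x != y); lia.
Qed.

(** * Adding one edge to a connected graph *)

Section AddEdge.
Variables (R : realType) (V : finType) (e : rel V) (u v : V).
Hypotheses (sym : symmetric e) (irr : irreflexive e).
Hypotheses (con : forall x y, connect e x y) (V3 : (3 <= #|V|)%N).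
Hypotheses (uv : u != v) (Neuv : ~~ e u v).

Definition add_edge : rel V :=
  [rel x y | [|| e x y, (x == u) && (y == v) | (x == v) && (y == u)]].

Lemma add_edge_sym : symmetric add_edge.
Proof.
move=> x y; rewrite /add_edge /= sym; congr orb.
by rewrite orbC; congr orb; rewrite andbC.
Qed.

Lemma add_edge_irrefl : irreflexive add_edge.
Proof.
move=> x; rewrite /add_edge /= irr /=.
by case: (eqVneq x u) => [->|]; rewrite ?(negbTE uv) //= andbF.
Qed.

Lemma add_edge_connected x y : connect add_edge x y.
Proof.
by move: (con x y); apply: connect_sub => z t ezt;
  rewrite connect1 // /add_edge /= ezt.
Qed.

Lemma rdegree_add_edge x :
  rdegree add_edge x = (rdegree e x + ((x == u) || (x == v)))%N.
Proof.
have Nevu : ~~ e v u by rewrite sym.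
have [->|xu] := eqVneq x u.
  rewrite /rdegree (_ : [set y | _] = v |: [set y | e u y]).
    by rewrite cardsU1 inE Neuv addnC.
  by apply/setP => y; rewrite !inE /add_edge /= eqxx (negbTE uv) /= orbF orbC.
have [->|xv] := eqVneq x v.
  rewrite /rdegree (_ : [set y | _] = u |: [set y | e v y]).
    by rewrite cardsU1 inE Nevu addnC.
  by apply/setP => y;
    rewrite !inE /add_edge /= eqxx [v == u]eq_sym (negbTE uv) orbC.
rewrite addn0; apply: eq_card => y.
by rewrite !inE /add_edge /= (negbTE xu) (negbTE xv) orbF.
Qed.

(** The loss allowed by [weight_drop], charged to an end [x] of an old arc; zero unless the degree
    of [x] is raised. *)
Let drop (x : V) : R :=
  ((x == u) || (x == v))%:R / (2 * Num.sqrt (rdegree e x).+1%:R).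

(** As u and v are not adjacent, at most one end of an old arc gains a neighbour, and [weight_drop]
    applies to that end. *)
Lemma weight_add_edge x y : e x y ->
  weight R (rdegree e x) (rdegree e y) - (drop x + drop y)
    <= weight R (rdegree add_edge x) (rdegree add_edge y).
Proof.
move=> exy; have deg3 := edge_rdegree_ge3 sym irr con V3 exy.
have dx : (0 < rdegree e x)%N by apply/card_gt0P; exists y; rewrite inE.
have dy : (0 < rdegree e y)%N by apply/card_gt0P; exists x; rewrite inE sym.
have Nboth : ~~ (((x == u) || (x == v)) && ((y == u) || (y == v))).
  apply: contraL exy => /andP[/orP[]/eqP-> /orP[]/eqP->]; rewrite ?irr //.
  by rewrite sym.
rewrite !rdegree_add_edge /drop; move: Nboth.
case: (_ || _) => /=; case: (_ || _) => //= _.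
- rewrite addn0 addn1 mul0r addr0 mul1r lerBlDr -lerBlDl.
  exact: weight_drop.
- rewrite addn0 addn1 mul0r add0r mul1r lerBlDr -lerBlDl.
  rewrite weightC [weight _ _ (_.+1)]weightC.
  by apply: weight_drop => //; rewrite addnC.
- by rewrite !addn0 !mul0r addr0 subr0.
Qed.

(** Reversing arcs shows that first and second ends contribute equally. Only u and v are charged,
    and at a vertex of degree d the total is 2 d / (2 sqrt(d + 1)) <= sqrt(d + 1). *)
Lemma sum_drop :
  \sum_(p : V * V | e p.1 p.2) (drop p.1 + drop p.2)
    <= Num.sqrt (rdegree e u).+1%:R + Num.sqrt (rdegree e v).+1%:R.
Proof.
have half : \sum_(p : V * V | e p.1 p.2) drop p.2 =
            \sum_(p : V * V | e p.1 p.2) drop p.1.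
  rewrite (reindex_inj (h := fun p => (p.2, p.1))) /=.
    by apply: eq_bigl => p /=; rewrite sym.
  by move=> [a b] [c d] /= [-> ->].
rewrite big_split /= half -mulr2n.
rewrite -(pair_big_dep xpredT (fun x y => e x y) (fun x _ => drop x)) /=.
under eq_bigr => x _.
  have -> : \sum_(y | e x y) drop x = drop x *+ rdegree e x.
    by rewrite sumr_const /rdegree; congr (_ *+ _); apply: eq_card => y;
      rewrite inE.
  over.
have one x : (x == u) || (x == v) ->
    (drop x *+ rdegree e x) *+ 2 <= Num.sqrt (rdegree e x).+1%:R.
  move=> xuv; rewrite /drop xuv mul1r.
  have s0 : 0 < Num.sqrt (rdegree e x).+1%:R :> R by rewrite sqrtr_gt0 ltr0n.
  rewrite -mulrnA -[_^-1 *+ _]mulr_natl ler_pdivrMr ?mulr_gt0 //.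
  rewrite mulrCA -expr2 sqr_sqrtr ?ler0n // mulnC natrM.
  by rewrite ler_pM2l ?ler_nat.
rewrite (bigD1 u) //= (bigD1 v) 1?eq_sym //= big1 => [|x /andP[xu xv]].
  by rewrite addr0 mulrnDl lerD // one // eqxx ?orbT.
by rewrite /drop (negbTE xu) (negbTE xv) mul0r mul0rn.
Qed.

Lemma arc_sum_add_edge : arc_sum R e < arc_sum R add_edge.
Proof.
have addeuv : add_edge u v by rewrite /add_edge /= !eqxx orbT.
have addevu : add_edge v u by rewrite /add_edge /= !eqxx !orbT.
(* By [weight_gt_half] at the raised degrees, the two new arcs together weigh more than the total
   loss bounded in [sum_drop]. *)
have := edge_rdegree_ge3 add_edge_sym add_edge_irrefl add_edge_connected V3
          addeuv.
move/(weight_gt_half R); rewrite !rdegree_add_edge !eqxx orbT /= !addn1 => new.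
rewrite {2}/arc_sum (bigD1 (u, v)) //= (bigD1 (v, u)) /=; last first.
  by rewrite addevu xpair_eqE [v == u]eq_sym (negbTE uv).
rewrite [weight _ (rdegree _ v) _]weightC addrA -mulr2n.
rewrite !rdegree_add_edge !eqxx orbT /= !addn1 -mulr_natl.
rewrite (eq_bigl (fun p : V * V => e p.1 p.2)); last first.
  case=> x y; rewrite /add_edge /= !xpair_eqE.
  case: (boolP (e x y)) => /= [exy|_].
    apply/andP; split; apply: contraTN exy => /andP[/eqP-> /eqP->] //.
    by rewrite sym.
  by do 4!case: eqP.
have : arc_sum R e - \sum_(p : V * V | e p.1 p.2) (drop p.1 + drop p.2) <=
  \sum_(p : V * V | e p.1 p.2)
     weight R (rdegree add_edge p.1) (rdegree add_edge p.2).
  by rewrite -sumrB; apply: ler_sum => p /weight_add_edge.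
have := sum_drop; lra.
Qed.

End AddEdge.

(** Missing edges are inserted one at a time, by induction on the number of arcs of [e'] absent from
    [e]; connectedness is preserved throughout. The strict alternative is what later settles the
    equality case. *)
Lemma arc_sum_subrel (R : realType) (V : finType) (e e' : rel V) :
  symmetric e -> irreflexive e -> (forall x y, connect e x y) ->
  symmetric e' -> irreflexive e' -> (3 <= #|V|)%N -> subrel e e' ->
  e =2 e' \/ arc_sum R e < arc_sum R e'.
Proof.
move=> sym irr con sym' irr' V3.
have [m] := ubnP #|[set p : V * V | e' p.1 p.2 && ~~ e p.1 p.2]|.
elim: m e sym irr con => // m IH e sym irr con lem sub.
have [[x y] /= /andP[exy' Nexy]|none] :=
  pickP [pred p : V * V | e' p.1 p.2 && ~~ e p.1 p.2]; last first.
  left=> x y; have /= := none (x, y); have := sub x y.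
  by case: (e x y) (e' x y) => [] [] // /(_ isT).
right; have xy : x != y by apply: contraTneq exy' => ->; rewrite irr'.
apply: (lt_le_trans (arc_sum_add_edge R sym irr con V3 xy Nexy)).
have [|||||E|/ltW//] := IH (add_edge e x y).
- exact: add_edge_sym.
- exact: add_edge_irrefl.
- exact: add_edge_connected.
- rewrite ltnS in lem; apply: leq_trans lem; apply/proper_card/properP; split.
    by apply/subsetP => p; rewrite !inE => /andP[->] /=;
      rewrite /add_edge /= negb_or => /andP[].
  by exists (x, y); rewrite !inE /= exy' // /add_edge /= !eqxx orbT.
- move=> a b /or3P[/sub//|/andP[/eqP->/eqP->]//|/andP[/eqP->/eqP->]].
  by rewrite sym'.
by rewrite (eq_arc_sum R E).
Qed.

(** * Graphs of the form (K_a u K_b) v K_k *)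

(* The label [None] marks the separating set, [Some true] and [Some false] the
   two sides that it separates. *)
Definition compatible (c d : option bool) : bool :=
  [|| c == None, d == None | c == d].

(** With k, a and b vertices labelled [None], [Some true] and [Some false], this is the adjacency of
    (K_a u K_b) v K_k. *)
Definition split_rel (V : finType) (l : V -> option bool) : rel V :=
  fun x y => (x != y) && compatible (l x) (l y).

Definition class_size (V : finType) (l : V -> option bool) (c : option bool) :=
  #|[set x | l x == c]|.

Lemma split_rel_sym (V : finType) (l : V -> option bool) :
  symmetric (split_rel l).
Proof.
move=> x y; rewrite /split_rel /compatible eq_sym; congr andb.
by rewrite orbCA [l x == l y]eq_sym.
Qed.

Lemma split_rel_irrefl (V : finType) (l : V -> option bool) :
  irreflexive (split_rel l).
Proof. by move=> x; rewrite /split_rel eqxx. Qed.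

Lemma sum_label (M : nmodType) (V : finType) (l : V -> option bool)
    (h : option bool -> M) :
  \sum_x h (l x) = h None *+ class_size l None
    + h (Some true) *+ class_size l (Some true)
    + h (Some false) *+ class_size l (Some false).
Proof.
have part c : \sum_(x | l x == c) h (l x) = h c *+ class_size l c.
  rewrite /class_size -sumr_const; apply: eq_big => x; first by rewrite inE.
  by move/eqP->.
rewrite -!part (bigID (fun x => l x == None)) /= -addrA; congr (_ + _).
rewrite (bigID (fun x => l x == Some true)) /=; congr (_ + _).
  by apply: eq_bigl => x; case: (l x) => [[]|].
by apply: eq_bigl => x; case: (l x) => [[]|].
Qed.

Lemma card_label (V : finType) (l : V -> option bool) (P : pred (option bool)) :
  #|[set x | P (l x)]| = (P None * class_size l None
    + P (Some true) * class_size l (Some true)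
    + P (Some false) * class_size l (Some false))%N.
Proof.
have := sum_label l (fun c => (P c)%:R : int).
rewrite -!mulrnA -!natrD => E.
apply/eqP; rewrite -(eqr_nat int) -E -sum1dep_card natr_sum big_mkcond /=.
by apply/eqP/eq_bigr => x _; case: (P _).
Qed.

Lemma class_size_total (V : finType) (l : V -> option bool) :
  #|V| = (class_size l None + class_size l (Some true)
           + class_size l (Some false))%N.
Proof.
have := card_label l xpredT; rewrite !mul1n => <-.
by apply/esym/eq_card => x; rewrite inE.
Qed.

(** The 1 subtracted is the vertex itself; the truncated subtraction is exact once the class of [c]
    is inhabited. *)
Definition label_degree (k a b : nat) (c : option bool) : nat :=
  match c with
  | None => k + a + b - 1
  | Some true => k + a - 1
  | Some false => k + b - 1
  end.

Lemma rdegree_split (V : finType) (l : V -> option bool) (x : V) :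
  rdegree (split_rel l) x =
  label_degree (class_size l None) (class_size l (Some true))
    (class_size l (Some false)) (l x).
Proof.
have := card_label l (compatible (l x)).
rewrite (cardsD1 x) inE (_ : compatible _ _); last first.
  by rewrite /compatible eqxx !orbT.
rewrite /rdegree (_ : [set y | split_rel l x y] =
  [set y | compatible (l x) (l y)] :\ x); last first.
  by apply/setP => y; rewrite !inE /split_rel eq_sym.
by case: (l x) => [[]|] /= E; lia.
Qed.

(** ASO of (K_a u K_b) v K_k, one term for each kind of edge, with the binomials written as real
    polynomials in k, a, b. *)
Definition split_value (R : realType) (k a b : nat) : R :=
  let w c d := weight R (label_degree k a b c) (label_degree k a b d) in
  k%:R * (k%:R - 1) / 2 * w None None
  + k%:R * a%:R * w None (Some true)
  + k%:R * b%:R * w None (Some false)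
  + a%:R * (a%:R - 1) / 2 * w (Some true) (Some true)
  + b%:R * (b%:R - 1) / 2 * w (Some false) (Some false).

Lemma arc_sum_split (R : realType) (V : finType) (l : V -> option bool) :
  arc_sum R (split_rel l) =
  2 * split_value R (class_size l None) (class_size l (Some true))
        (class_size l (Some false)).
Proof.
set k := class_size l None; set a := class_size l (Some true).
set b := class_size l (Some false).
pose D := label_degree k a b.
pose h c d := if compatible c d then weight R (D c) (D d) else 0.
(* Summing over whole classes also counts x as its own neighbour; the last term removes it. *)
have inner x : \sum_(y | split_rel l x y)
    weight R (rdegree (split_rel l) x) (rdegree (split_rel l) y) =
    h (l x) None *+ k + h (l x) (Some true) *+ a + h (l x) (Some false) *+ b
      - h (l x) (l x).
  rewrite -(sum_label l (h (l x))) [X in X - _](bigD1 x) //= addrAC subrr add0r.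
  rewrite [RHS](bigID (fun y => compatible (l x) (l y))) /=.
  rewrite [X in _ + X]big1 ?addr0 => [|y /andP[_ /negbTE cF]]; last first.
    by rewrite /h cF.
  apply: eq_big => [y|y /andP[_ c]]; first by rewrite /split_rel eq_sym.
  by rewrite !rdegree_split /h c.
rewrite /arc_sum -(pair_big_dep xpredT (fun x y => split_rel l x y)
  (fun x y => weight R (rdegree (split_rel l) x) (rdegree (split_rel l) y))) /=.
under eq_bigr => x _ do rewrite inner.
rewrite (sum_label l (fun c => h c None *+ k + h c (Some true) *+ a
   + h c (Some false) *+ b - h c c)) -/k -/a -/b /h /=.
rewrite /split_value -/D
  [weight _ (D (Some true)) (D None)]weightC
  [weight _ (D (Some false)) (D None)]weightC.
by field.
Qed.

(** * Comparison of the split values with the bound *)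

Lemma natr_bin2 (R : realType) n : 'C(n, 2)%:R = n%:R * (n%:R - 1) / 2 :> R.
Proof.
elim: n => [|n IH]; first by rewrite bin0n mul0r mul0r.
by rewrite binS bin1 natrD IH -natr1; field.
Qed.

(** With n = k + b + 1 the degrees are n - 1, k and n - 2, and the radicands of the bound come from
    those of the weights by polynomial division. The case b = 0 is the complete graph. *)
Lemma split_value_bound (R : realType) (k b : nat) : (3 <= k + b)%N ->
  split_value R k 1 b = ASO_bound R (k + b).+1 k.
Proof.
move=> kb; have kbR : 3 <= k%:R + b%:R :> R by rewrite -natrD ler_nat.
rewrite /split_value /ASO_bound /= !natr_bin2 /weight.
have -> : (k + 1 + b - 1 = k + b)%N by lia.
have -> : (k + 1 - 1 = k)%N by lia.
have -> : ((k + b).+1 - k - 1 = b)%N by lia.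
have E : (k + b - 1)%:R = k%:R + b%:R - 1 :> R.
  by rewrite natrB ?natrD //; lia.
rewrite !E -![(k + b).+1%:R]natr1 !natrD natrM.
have -> : (k%:R + b%:R + 1 - 1) ^+ 2 + k%:R ^+ 2 =
          (k%:R + b%:R) ^+ 2 + k%:R ^+ 2 :> R by ring.
have -> : k%:R + b%:R + 1 + k%:R - 3 = k%:R + b%:R + k%:R - 2 :> R by ring.
have -> : k%:R + b%:R + 1 + 1 / (k%:R + b%:R + 1 - 2) =
   ((k%:R + b%:R) ^+ 2 + (k%:R + b%:R) ^+ 2)
     / (k%:R + b%:R + (k%:R + b%:R) - 2) :> R.
  by field; do ?[apply/andP; split]; apply/eqP; lra.
have -> : k%:R + b%:R + 1 - 1 / 2 + 5 / (2 * (2 * (k%:R + b%:R + 1) - 5)) =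
   ((k%:R + b%:R) ^+ 2 + (k%:R + b%:R - 1) ^+ 2)
     / (k%:R + b%:R + (k%:R + b%:R - 1) - 2) :> R.
  by field; do ?[apply/andP; split]; apply/eqP; lra.
have -> : k%:R + b%:R + 1 - 1 + 1 / (k%:R + b%:R + 1 - 3) =
   ((k%:R + b%:R - 1) ^+ 2 + (k%:R + b%:R - 1) ^+ 2)
     / (k%:R + b%:R - 1 + (k%:R + b%:R - 1) - 2) :> R.
  by field; do ?[apply/andP; split]; apply/eqP; lra.
by field.
Qed.

Lemma split_value_lt (R : realType) (k a b : nat) :
  (0 < k)%N -> (2 <= a)%N -> (2 <= b)%N ->
  split_value R k a b < split_value R k 1 (a + b - 1).
Proof.
(* With n = k + a + b, m = n - 2 is the degree in the large clique of the competitor, and m + 1 the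
   degree in K_k. *)
move=> k0 a2 b2; pose m := (k + a + b - 2)%N.
have m3 : (3 <= m)%N by rewrite /m; lia.
rewrite /split_value /=.
have -> : (k + 1 + (a + b - 1) - 1 = m.+1)%N by rewrite /m; lia.
have -> : (k + 1 - 1 = k)%N by lia.
have -> : (k + (a + b - 1) - 1 = m)%N by rewrite /m; lia.
have -> : (k + a + b - 1 = m.+1)%N by rewrite /m; lia.
have kR : 1 <= k%:R :> R by rewrite ler1n.
have aR : 2 <= a%:R :> R by rewrite ler_nat.
have bR : 2 <= b%:R :> R by rewrite ler_nat.
have mE : m%:R = k%:R + a%:R + b%:R - 2 :> R by rewrite natrB ?natrD //; lia.
have -> : (a + b - 1)%:R = a%:R + b%:R - 1 :> R by rewrite natrB ?natrD //; lia.
have [amin bmin] : (2 <= k + a - 1 <= m)%N /\ (2 <= k + b - 1 <= m)%N.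
  by rewrite /m; lia.
have Fa := weight_le_corner R m3 amin; have Fb := weight_le_corner R m3 bmin.
have wa : weight R (k + a - 1) (k + a - 1) <= weight R m m.
  by case/andP: amin => *; apply: weight_diag_mono.
have wb : weight R (k + b - 1) (k + b - 1) <= weight R m m.
  by case/andP: bmin => *; apply: weight_diag_mono.
have F2 : weight R m.+1 m ^+ 2 <= m%:R + 2.
  rewrite weight_sqr; last by lia.
  have mR : 3 <= m%:R :> R by rewrite ler_nat.
  by rewrite -natr1 ler_pdivrMr; [nra | lra].
have f2 : (m.+1%:R + k%:R) / 2 + 1 <= weight R m.+1 k ^+ 2.
  by apply: weight_sqr_ge; lia.
have w2 : (m%:R + m%:R) / 2 + 1 <= weight R m m ^+ 2.
  by apply: weight_sqr_ge; lia.
have F0 := weight_ge0 R m.+1 m; have f0 := weight_ge0 R m.+1 k.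
have w0 := weight_ge0 R m m.
(* Write F, f, w for f(m+1, m), f(m+1, k), f(m, m). If F > f, multiply by F + f: k (F^2 - f^2) <= k
   (a + b - 1) / 2 < 2 k (a + b - 3) <= 2 k (a - 1)(b - 1) <= (a - 1)(b - 1) w (F + f), the last
   step because w F >= w f >= k. *)
have key : k%:R * (weight R m.+1 m - weight R m.+1 k)
             < (a%:R - 1) * (b%:R - 1) * weight R m m.
  move: F2 f2 w2 F0 f0 w0; rewrite -[m.+1%:R]natr1 mE.
  move: (weight R m.+1 m) (weight R m.+1 k) (weight R m m) => F f w.
  move=> F2 f2 w2 F0 f0 w0.
  have w_gt0 : 0 < w.
    rewrite lt0r w0 andbT; apply: contraTneq w2 => ->.
    by rewrite -ltNge expr0n /=; lra.
  have f_gt0 : 0 < f.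
    rewrite lt0r f0 andbT; apply: contraTneq f2 => ->.
    by rewrite -ltNge expr0n /=; lra.
  have M1 : a%:R + b%:R - 3 <= (a%:R - 1) * (b%:R - 1) :> R by nra.
  have [Ff|fF] := leP F f.
    apply: (@le_lt_trans _ _ 0); first by rewrite mulr_ge0_le0 //; lra.
    by rewrite mulr_gt0 //; nra.
  have wf : k%:R <= w * f.
    rewrite -(ler_pXn2r (n := 2)) // ?nnegrE ?mulr_ge0 //.
    by rewrite exprMn expr2; apply: ler_pM => //; lra.
  have prod : (F - f) * (F + f) <= (a%:R + b%:R - 1) / 2 by nra.
  rewrite ltNge; apply/negP => contra.
  have : (a%:R - 1) * (b%:R - 1) * w * (F + f) <= k%:R * (F - f) * (F + f).
    by rewrite ler_wpM2r //; lra.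
  have : k%:R * ((F - f) * (F + f)) <= k%:R * ((a%:R + b%:R - 1) / 2).
    by rewrite ler_wpM2l.
  have : (a%:R - 1) * (b%:R - 1) * (k%:R * 2) <=
         (a%:R - 1) * (b%:R - 1) * (w * (F + f)).
    rewrite ler_wpM2l //; first by nra.
    have : w * f <= w * F by rewrite ler_wpM2l // ltW.
    by rewrite mulrDr; lra.
  have : (a%:R + b%:R - 3) * (k%:R * 2) <=
         (a%:R - 1) * (b%:R - 1) * (k%:R * 2) :> R.
    by apply: ler_wpM2r M1; lra.
  (* Strictness: 2 (a + b - 3) exceeds (a + b - 1) / 2 by (3 (a + b) - 11) / 2, positive since a + b
     >= 4. *)
  have : 0 < k%:R * (3 * (a%:R + b%:R) - 11) :> R by rewrite mulr_gt0 //; lra.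
  rewrite !mulrA; nra.
have Fa' : k%:R * a%:R * weight R m.+1 (k + a - 1)
             <= k%:R * a%:R * weight R m.+1 m
  by rewrite ler_wpM2l ?mulr_ge0.
have Fb' : k%:R * b%:R * weight R m.+1 (k + b - 1)
             <= k%:R * b%:R * weight R m.+1 m
  by rewrite ler_wpM2l ?mulr_ge0.
have wa' : a%:R * (a%:R - 1) / 2 * weight R (k + a - 1) (k + a - 1)
             <= a%:R * (a%:R - 1) / 2 * weight R m m.
  by rewrite ler_wpM2l //; nra.
have wb' : b%:R * (b%:R - 1) / 2 * weight R (k + b - 1) (k + b - 1)
             <= b%:R * (b%:R - 1) / 2 * weight R m m.
  by rewrite ler_wpM2l //; nra.
lra.
Qed.

(** * Graphs contained in a split graph, and isomorphism of split graphs *)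

Lemma ASO_split (R : realType) (G : sgraph) (l : G -> option bool) :
  @adj G =2 split_rel l ->
  ASO R G = split_value R (class_size l None) (class_size l (Some true))
              (class_size l (Some false)).
Proof.
move=> E; have := ASO_arc_sum R G.
by rewrite (eq_arc_sum R E) arc_sum_split; lra.
Qed.

Lemma ASO_sub_split (R : realType) (G : sgraph) (l : G -> option bool) :
  connected G -> (3 <= #|G|)%N -> subrel (@adj G) (split_rel l) ->
  @adj G =2 split_rel l \/
  ASO R G < split_value R (class_size l None) (class_size l (Some true))
              (class_size l (Some false)).
Proof.
move=> con G3 sub; have {}con x y : connect (@adj G) x y.
  by move/forallP/(_ x)/forallP: con; apply.
have [E|lt] := arc_sum_subrel R (@adj_sym G) (@adj_irrefl G) con
  (@split_rel_sym _ l) (@split_rel_irrefl _ l) G3 sub; [by left|right].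
by move: lt; rewrite -ASO_arc_sum arc_sum_split; lra.
Qed.

(** The i-th vertex of each class is sent to the i-th vertex of the class with the same label.
    Adjacency depends only on labels and distinctness, so an injection preserving labels preserves
    it. *)
Lemma isomorphic_split (G H : sgraph) (lG : G -> option bool)
    (lH : H -> option bool) :
  @adj G =2 split_rel lG -> @adj H =2 split_rel lH ->
  (forall c, class_size lG c = class_size lH c) -> isomorphic G H.
Proof.
move=> EG EH sz.
pose sG c := enum [set x | lG x == c]; pose sH c := enum [set x | lH x == c].
have szE c : size (sG c) = size (sH c) by rewrite -!cardE; apply: sz.
have inG x : x \in sG (lG x) by rewrite mem_enum inE.
have idx x : (index x (sG (lG x)) < size (sH (lG x)))%N.
  by rewrite -szE index_mem.
have nonempty x : exists y, y \in sH (lG x).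
  have : (0 < size (sH (lG x)))%N by apply: leq_ltn_trans (idx x).
  by case: (sH _) => // y s _; exists y; rewrite mem_head.
(* [nth] needs an element of [H], which is not known to be inhabited; the class with the label of
   [x] supplies one. *)
have dflt (x : G) : H := xchoose (nonempty x).
pose f x := nth (dflt x) (sH (lG x)) (index x (sG (lG x))).
have lf x : lH (f x) = lG x.
  by have := mem_nth (dflt x) (idx x); rewrite mem_enum inE => /eqP.
have f_inj : injective f.
  move=> x y Exy; have lxy : lG x = lG y by rewrite -!lf Exy.
  move: Exy (idx y) (inG y); rewrite /f -lxy => Exy idy iny.
  rewrite (set_nth_default (dflt x) (dflt y)) // in Exy.
  move/eqP: Exy; rewrite nth_uniq ?enum_uniq // => /eqP Ei.
  by rewrite -(nth_index x (inG x)) Ei nth_index.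
have cardE : #|G| = #|H| by rewrite (class_size_total lG) (class_size_total lH) !sz.
exists f; first by apply: inj_card_bij => //; rewrite cardE.
by move=> x y; rewrite EG EH /split_rel !lf (inj_eq f_inj).
Qed.

(** * The extremal graph (K_1 u K_b) v K_k *)

Section PendantJoin.
Variables k b : nat.

Definition pendant_join : sgraph :=
  join (disjoint_union (complete 1) (complete b)) (complete k).

Definition pendant_label (z : pendant_join) : option bool :=
  match z with
  | inl (inl _) => Some true
  | inl (inr _) => Some false
  | inr _ => None
  end.

Lemma pendant_join_split : @adj pendant_join =2 split_rel pendant_label.
Proof. by case=> [[x|x]|x] [[y|y]|y] //=; rewrite /split_rel /= andbT. Qed.

Lemma pendant_class_size :
  [/\ class_size pendant_label None = k,
      class_size pendant_label (Some true) = 1%N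
    & class_size pendant_label (Some false) = b].
Proof.
have sz (m : nat) (c : option bool) (g : 'I_m -> pendant_join) : injective g ->
    (forall z, (pendant_label z == c) = (z \in codom g)) ->
    class_size pendant_label c = m.
  move=> g_inj gP; rewrite /class_size -[RHS]card_ord -(card_codom g_inj).
  by apply: eq_card => z; rewrite inE gP.
split.
- apply: (@sz k _ (fun i => inr i)) => [i j [//]|z].
  case: z => [[z|z]|z] /=; apply/esym.
  + by apply/codomP => -[].
  + by apply/codomP => -[].
  + by apply/codomP; exists z.
- apply: (@sz 1%N _ (fun i => inl (inl i))) => [i j [//]|z].
  case: z => [[z|z]|z] /=; apply/esym.
  + by apply/codomP; exists z.
  + by apply/codomP => -[].
  + by apply/codomP => -[].
- apply: (@sz b _ (fun i => inl (inr i))) => [i j [//]|z].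
  case: z => [[z|z]|z] /=; apply/esym.
  + by apply/codomP => -[].
  + by apply/codomP; exists z.
  + by apply/codomP => -[].
Qed.

End PendantJoin.

Lemma ASO_pendant_join (R : realType) (G : sgraph) (k b : nat) :
  (3 <= k + b)%N -> isomorphic G (pendant_join k b) ->
  ASO R G = ASO_bound R (k + b).+1 k.
Proof.
move=> kb [f f_bij f_mono]; rewrite -split_value_bound //.
pose l x := pendant_label (f x).
have E : @adj G =2 split_rel l.
  move=> x y; rewrite -f_mono pendant_join_split /split_rel.
  by rewrite (inj_eq (bij_inj f_bij)).
have sz c : class_size l c = class_size (@pendant_label k b) c.
  rewrite /class_size -(on_card_preimset (f := f)); last first.
    by apply: onW_bij.
  by apply: eq_card => x; rewrite !inE.
by rewrite (ASO_split R E) !sz; case: (pendant_class_size k b) => -> -> ->.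
Qed.

(** * The complete graph, extremal for k = n - 1 *)

Section Apex.
Variables (V : finType) (x0 : V).

(* A clique is the degenerate split with one side empty and the other one a
   single vertex. *)
Definition apex_label (x : V) : option bool :=
  if x == x0 then Some true else None.

Lemma apex_split x y : split_rel apex_label x y = (x != y).
Proof.
rewrite /split_rel /compatible /apex_label.
by case: (x == x0); case: (y == x0); rewrite andbT.
Qed.

Lemma apex_class_size :
  [/\ class_size apex_label None = (#|V| - 1)%N,
      class_size apex_label (Some true) = 1%N
    & class_size apex_label (Some false) = 0%N].
Proof.
rewrite /class_size /apex_label; split.
- rewrite subn1 -(cardC1 x0); apply: eq_card => x.
  by rewrite !inE /=; case: (x == x0).
- by rewrite -(cards1 x0); apply: eq_card => x;
    rewrite !inE /=; case: (x == x0).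
- by apply: eq_card0 => x; rewrite !inE /=; case: (x == x0).
Qed.

End Apex.

Lemma ASO_complete (R : realType) (G : sgraph) : (4 <= #|G|)%N ->
  (forall x y : G, adj x y = (x != y)) -> ASO R G = ASO_bound R #|G| (#|G| - 1).
Proof.
move=> G4 E; have /card_gt0P[x0 _] : (0 < #|G|)%N by lia.
have E' : @adj G =2 split_rel (apex_label x0) by move=> x y; rewrite apex_split.
rewrite (ASO_split R E'); case: (apex_class_size x0) => -> -> ->.
rewrite split_value_bound; last by lia.
by congr (ASO_bound R _ _); lia.
Qed.

Lemma ASO_le_complete (R : realType) (G : sgraph) :
  connected G -> (4 <= #|G|)%N ->
  (forall x y : G, adj x y = (x != y)) \/
  ASO R G < ASO_bound R #|G| (#|G| - 1).
Proof.
move=> con G4; have /card_gt0P[x0 _] : (0 < #|G|)%N by lia.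
have sub : subrel (@adj G) (split_rel (apex_label x0)).
  move=> x y axy; rewrite apex_split.
  by apply: contraTneq axy => ->; rewrite adj_irrefl.
have [|E|] := ASO_sub_split R con _ sub; first by lia.
  by left=> x y; rewrite E apex_split.
case: (apex_class_size x0) => -> -> -> lt; right.
move: lt; rewrite split_value_bound; last by lia.
by have -> : (#|G| - 1 + 0).+1 = #|G| by lia.
Qed.

Lemma isomorphic_completeP (G : sgraph) (n : nat) : #|G| = n ->
  isomorphic G (complete n) <-> (forall x y : G, adj x y = (x != y)).
Proof.
move=> <-; split=> [[f f_bij f_mono] x y|E].
  by rewrite -f_mono /= (inj_eq (bij_inj f_bij)).
exists (@enum_rank G); first exact: enum_rank_bij.
by move=> x y /=; rewrite E (inj_eq enum_rank_inj).
Qed.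

(** * Vertex connectivity and separations *)

Lemma vertex_connectivityP (G : sgraph) :
  exists S : {set G}, [/\ #|S| = vertex_connectivity G, disconnecting S
    & forall T : {set G}, disconnecting T -> (#|S| <= #|T|)%N].
Proof.
rewrite /vertex_connectivity; case: arg_minnP => [|S dS minS].
  rewrite /disconnecting; apply/orP; left.
  by rewrite /= card_sig eq_card0 // => x; rewrite !inE.
by exists S; split.
Qed.

Lemma card_remaining (G : sgraph) (S : {set G}) :
  #|remove_vertices S| = (#|G| - #|S|)%N.
Proof.
rewrite /= card_sig -[in RHS](setCK S) -cardsCs.
by apply: eq_card => x; rewrite !inE.
Qed.

(** Removing all vertices but one leaves a trivial graph. *)
Lemma vertex_connectivity_le (G : sgraph) : (0 < #|G|)%N ->
  (vertex_connectivity G <= #|G| - 1)%N.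
Proof.
move=> /card_gt0P[x _]; have [S [<- _ minS]] := vertex_connectivityP G.
have <- : #|[set~ x]| = (#|G| - 1)%N by rewrite cardsC1 subn1.
apply: minS; apply/orP; left; rewrite card_remaining cardsC1.
by have : (0 < #|G|)%N by [apply/card_gt0P; exists x]; lia.
Qed.

(** A minimum disconnecting set S gets [None], the component of some x outside S gets [Some true],
    and the remaining vertices get [Some false]. No edge leaves a component without entering S. *)
Lemma separating_label (G : sgraph) : connected G ->
  (vertex_connectivity G <= #|G| - 2)%N -> (2 <= #|G|)%N ->
  exists l : G -> option bool,
    [/\ subrel (@adj G) (split_rel l), class_size l None = vertex_connectivity G,
        (0 < class_size l None)%N, (0 < class_size l (Some true))%N
      & (0 < class_size l (Some false))%N].
Proof.
move=> con small G2; have [S [cS dS _]] := vertex_connectivityP G.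
move: dS; rewrite /disconnecting card_remaining cS.
(* At least two vertices remain, so S truly disconnects and does not merely leave a trivial
   graph. *)
have -> : (#|G| - vertex_connectivity G <= 1)%N = false by lia.
rewrite /= negb_forall => /existsP[x]; rewrite negb_forall => /existsP[y nxy].
pose r := @adj (remove_vertices S).
pose l (z : G) : option bool :=
  if insub z is Some t then Some (connect r x t) else None.
have lval (t : remove_vertices S) : l (val t) = Some (connect r x t).
  by rewrite /l valK.
have lNone z : (l z == None) = (z \in S).
  by rewrite /l; case: insubP => [t /negbTE->|/negbNE->].
have sub : subrel (@adj G) (split_rel l).
  move=> u v auv; apply/andP; split.
    by apply: contraTneq auv => ->; rewrite adj_irrefl.
  rewrite /compatible !lNone; case: (boolP (u \in S)) => //= uS.
  case: (boolP (v \in S)) => //= vS.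
  rewrite -[u](SubK (remove_vertices S) uS) -[v](SubK (remove_vertices S) vS).
  rewrite !lval; apply/eqP; congr Some.
  apply: (same_connect_r (sym_connect_sym (@adj_sym _))).
  exact: connect1.
have szN : class_size l None = vertex_connectivity G.
  by rewrite -cS; apply: eq_card => z; rewrite inE lNone.
have szT : (0 < class_size l (Some true))%N.
  by apply/card_gt0P; exists (val x); rewrite inE lval connect0.
have szF : (0 < class_size l (Some false))%N.
  by apply/card_gt0P; exists (val y); rewrite inE lval (negbTE nxy).
(* If S were empty, the [Some true] class would be closed under adjacency, so no path of the
   connected [G] could lead from x to y. *)
exists l; split=> //; rewrite lt0n; apply/negP => /eqP sz0.
have lN z : l z != None.
  apply/negP => lz; have : (0 < class_size l None)%N.
    by apply/card_gt0P; exists z; rewrite inE.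
  by rewrite sz0.
have clo : closed (@adj G) [pred z | l z == Some true].
  move=> u v auv; have /andP[_] := sub u v auv.
  by rewrite /compatible !inE (negbTE (lN u)) (negbTE (lN v)) /= => /eqP->.
have /forallP/(_ (val x))/forallP/(_ (val y)) := con.
move/(closed_connect clo); rewrite !inE !lval connect0 (negbTE nxy).
by [].
Qed.

(** * The bound for k <= n - 2 and the conclusion *)

Lemma class_size_swap (V : finType) (l : V -> option bool) c :
  class_size (omap negb \o l) c = class_size l (omap negb c).
Proof.
apply: eq_card => x; rewrite !inE /=.
by case: (l x) c => [[]|] [[]|].
Qed.

Lemma split_rel_swap (V : finType) (l : V -> option bool) :
  split_rel (omap negb \o l) =2 split_rel l.
Proof.
by move=> x y;
  rewrite /split_rel /compatible /=; case: (l x) (l y) => [[]|] [[]|].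
Qed.

(** If one side of the separation is a single vertex, completing [G] yields the extremal graph, and
    strictly raises ASO unless nothing was missing. If both sides have at least two vertices,
    [split_value_lt] makes the inequality strict. *)
Lemma ASO_le_pendant_join (R : realType) (G : sgraph) (k : nat) :
  connected G -> (4 <= #|G|)%N -> vertex_connectivity G = k ->
  (k <= #|G| - 2)%N ->
  isomorphic G (pendant_join k (#|G| - k - 1)) \/ ASO R G < ASO_bound R #|G| k.
Proof.
move=> con G4 Ek kn; have G3 : (3 <= #|G|)%N by lia.
have pendant (l : G -> option bool) : subrel (@adj G) (split_rel l) ->
    class_size l None = k -> class_size l (Some true) = 1%N ->
    isomorphic G (pendant_join k (#|G| - k - 1)) \/ ASO R G < ASO_bound R #|G| k.
  move=> sub szN szT; have tot := class_size_total l.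
  have [E|lt] := ASO_sub_split R con G3 sub; [left|right].
    apply: (isomorphic_split E (@pendant_join_split _ _)).
    case: (pendant_class_size k (#|G| - k - 1)) => N T F.
    by case=> [[]|]; rewrite ?N ?T ?F //; lia.
  move: lt; rewrite szN szT split_value_bound; last by lia.
  by have -> : (k + class_size l (Some false)).+1 = #|G| by lia.
have [||l [sub szN k0 a0 b0]] := separating_label con;
  rewrite ?Ek //; first by lia.
have tot := class_size_total l.
have [a1|a1] := eqVneq (class_size l (Some true)) 1%N.
  by apply: (pendant l) => //; rewrite szN.
have [b1|b1] := eqVneq (class_size l (Some false)) 1%N.
  (* Exchanging the labels of the two sides makes the singleton side [Some true]. *)
  apply: (pendant (omap negb \o l));
    rewrite ?class_size_swap //=; last by rewrite szN.
  by move=> x y /sub; rewrite split_rel_swap.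
have a2 : (1 < class_size l (Some true))%N by lia.
have b2 : (1 < class_size l (Some false))%N by lia.
right; have lt : split_value R (class_size l None) (class_size l (Some true))
    (class_size l (Some false)) < ASO_bound R #|G| k.
  apply: lt_le_trans (split_value_lt R k0 a2 b2) _.
  rewrite split_value_bound; last by lia.
  rewrite szN Ek.
  by have -> : (k + (class_size l (Some true) + class_size l (Some false) - 1)).+1
     = #|G| by lia.
have [/(ASO_split R)->//|] := ASO_sub_split R con G3 sub.
by move/lt_trans; apply.
Qed.

Theorem theorem3 (R : realType) (G : sgraph) (n k : nat)
    (hconn : connected G) (hn : #|G| = n) (hn4 : (4 <= n)%N)
    (hk : vertex_connectivity G = k) :
  [/\ ASO R G <= ASO_bound R n k,
      (k <= n - 2)%N ->
        (ASO R G = ASO_bound R n k <->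
         isomorphic G
           (join (disjoint_union (complete 1) (complete (n - k - 1)))
                 (complete k)))
    & k = (n - 1)%N ->
        (ASO R G = ASO_bound R n k <-> isomorphic G (complete n))].
Proof.
have kn : (k <= n - 1)%N.
  by rewrite -hk -hn; apply: vertex_connectivity_le; rewrite hn; lia.
have G4 : (4 <= #|G|)%N by rewrite hn.
have [k2|k1] := leqP k (n - 2).
  have iso_eq : isomorphic G (pendant_join k (n - k - 1)) ->
      ASO R G = ASO_bound R n k.
    move=> /(ASO_pendant_join R) ->; last by lia.
    by congr (ASO_bound R _ _); lia.
  (* Being extremal or strictly below the bound yields both the inequality and the forward half of
     the equivalence. *)
  have := ASO_le_pendant_join R hconn G4 hk; rewrite hn => /(_ k2) dich.
  split=> [|_|]; last by lia.
    by case: dich => [/iso_eq->|/ltW].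
  split=> // E; case: dich => //; by rewrite E ltxx.
have {kn k1} kE : k = (n - 1)%N by lia.
have iso_eq : (forall x y : G, adj x y = (x != y)) -> ASO R G = ASO_bound R n k.
  by move=> /(ASO_complete R G4); rewrite hn kE.
have := ASO_le_complete R hconn G4; rewrite hn -kE => dich.
split=> [|k2|_]; [by case: dich => [/iso_eq->|/ltW] | by lia |].
split=> [E|/(isomorphic_completeP hn)/iso_eq//].
by apply/(isomorphic_completeP hn); case: dich => //; rewrite E ltxx.
Qed.
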